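(* Let $a$ be a collision kernel and $b$ a daughter distribution function satisfying the standing assumptions (K) and (B) of the context, and assume that there are $A_1>0$ and $\ell\ge 0$ with $\omega_0(x)\le A_1x^\ell$ for all $x\in(0,1)$. Let $g\in\mathcal G_b$ and $f^{\rm in}\in\Xi_0\cap\Xi_g^+$, and put $\Theta:=\int_0^\infty xf^{\rm in}(x)\,dx$. Assume either $\ell>\tfrac12$ and $T=\infty$, or $\ell\in(0,\tfrac12)$ and $T\in(0,\infty)$. Let $f$ be the constructed weak solution on $[0,T)$ described in the context (the limit of the truncated solutions). Then for all $t\in(0,T)$ $$s\mapsto\int_0^\infty\!\int_0^\infty y\,a(y,z)f(s,y)f(s,z)\,dy\,dz\ \in L^1(0,t),$$ and consequently $f$ is mass-conserving on $[0,T)$: $\int_0^\infty xf(t,x)\,dx=\Theta$ for all $t\in[0,T)$.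
   Context: **Equation.** The collision-induced breakage equation, for $t>0$, $x\in(0,\infty)$, is $$\partial_t f(t,x)=\int_0^\infty\!\int_x^\infty b(x,y,z)a(y,z)f(t,y)f(t,z)\,dy\,dz-\int_0^\infty a(x,y)f(t,x)f(t,y)\,dy,\qquad f(0,x)=f^{\rm in}(x).$$ **(K) Kernel.** $a(x,y)=a(y,x)\ge0$ has the form $a(x,y)=A_0\,\omega(x)\omega(y)$ with a constant $A_0>0$, where $\omega=\omega_0$ on $(0,1]$ and $\omega=\omega_\infty$ on $(1,\infty)$, and $\omega_0,\omega_\infty:[0,\infty)\to[0,\infty)$ are continuous non-decreasing functions. **(B) Daughter distribution.** $b$ is a nonnegative measurable function on $(0,\infty)^3$ such that for all $(y,z)\in(0,\infty)^2$: $\int_0^y x\,b(x,y,z)\,dx=y$ and $b(x,y,z)=0$ for $x>y$; $\int_0^y b(x,y,z)\,dx\le\beta_0$ for a constant $\beta_0\ge2$; and $\int_0^y b(x,y,z)^p\,dx\le \frac{B_p}{2}y^{1-p}$ for some constants $p\in(1,2)$, $B_p>0$. **Spaces.** For a measurable weight $g:(0,\infty)\to[0,\infty)$, $\Xi_g:=L^1((0,\infty),g(y)\,dy)$ and $\Xi_g^+$ is its cone of a.e. nonnegative functions; $\Xi_0=L^1(0,\infty)$; $\Xi_{0,w}$ is $\Xi_0$ with its weak topology; $L^1_w(0,R)$ is $L^1(0,R)$ with its weak topology. Convergence $f_n\to f$ in $\mathcal C([0,T'];L^1_w(0,R))$ means $\sup_{t\in[0,T']}\big|\int_0^R\varphi(x)(f_n(t,x)-f(t,x))\,dx\big|\to0$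 for every $\varphi\in L^\infty(0,R)$. **Weights.** $\mathcal G_b$ is the set of $g\in L^1_{\rm loc}(\mathbb R_+)$ such that $g(x)>0$ for all $x>0$, $g(x)/x$ is non-decreasing on $(0,\infty)$, and, for some constant $\theta\in(0,1)$ depending only on $g$, $g(y)-\int_0^y g(x)b(x,y,z)\,dx\ge\theta g(y)$ for all $(y,z)\in(0,\infty)^2$. **Weak solution.** For $T\in(0,\infty]$, a weak solution on $[0,T)$ is a nonnegative $f\in\mathcal C([0,T);\Xi_{0,w})\cap L^\infty((0,T);\Xi_g^+)$ such that for all $t\in(0,T)$ the function $(s,x,y)\mapsto a(x,y)f(s,x)f(s,y)$ belongs to $L^1((0,t)\times(0,\infty)^2)$ and for all $\psi\in L^\infty(0,\infty)$ $$\int_0^\infty\psi(x)(f(t,x)-f^{\rm in}(x))\,dx=\int_0^t\!\int_0^\infty\!\int_0^\infty\tilde\psi(y,z)a(y,z)f(s,y)f(s,z)\,dy\,dz\,ds,$$ where $\tilde\psi(y,z):=\int_0^y\psi(x)b(x,y,z)\,dx-\psi(y)$. **Truncated solutions.** For each integer $n\ge1$, $f_n\in C^1([0,\infty);L^1(0,n))$ is the unique non-negative solution of $$\partial_t f_n(t,x)=\int_0^n\!\int_x^n b(x,y,z)a(y,z)f_n(t,y)f_n(t,z)\,dy\,dz-\int_0^n a(x,y)f_n(t,x)f_n(t,y)\,dy,\quad x\in(0,n),$$ with $f_n(0,x)=f^{\rm in}(x)\mathbf 1_{(0,n)}(x)$. **Constructed weak solution.** $f$ is a weak solution on $[0,T)$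 (on $[0,T]$ if $T<\infty$, i.e. with $[0,T)$ replaced by $[0,T]$ and $t\in(0,T]$ in the definition) that is the limit of a subsequence of $(f_n)_{n\ge1}$ in $\mathcal C([0,T'];L^1_w(0,R))$ for every $R>1$ and every finite $T'\in(0,T]$; it belongs to $\mathcal C([0,T);\Xi_0)\cap L^\infty((0,T);\Xi_g^+)$ (with $\mathcal C([0,T];\Xi_0)$ if $T<\infty$) and satisfies $\int_0^\infty xf(t,x)\,dx\le\Theta$ on its interval of existence. *)

(* Defs.v *)
From mathcomp Require Import all_boot all_order all_algebra.
From mathcomp Require Import all_classical all_reals all_analysis.

Set Implicit Arguments.
Unset Strict Implicit.
Unset Printing Implicit Defensive.

Import Order.TTheory GRing.Theory Num.Theory.
Import numFieldNormedType.Exports.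

Local Open Scope classical_set_scope.
Local Open Scope ring_scope.

Notation leb := (@lebesgue_measure _).

Definition pos (R : realType) : set R := `]0, +oo[.
Arguments pos {R}.

(* Elements of L^1 and L^oo are represented by genuine functions R -> R, of
   which only the values on the relevant set matter; measurability is Borel
   measurability. *)
Section FunctionSpaces.
Context {R : realType}.
Implicit Types (D I : set R) (u v : R -> R) (F G : R -> R -> R).

Definition Lone D u : Prop := leb.-integrable D (EFin \o u).

Definition Linfty D u : Prop :=
  measurable_fun D u /\
  exists M : R, {ae leb, forall x, D x -> `|u x| <= M}.

Definition ae_nonneg D u : Prop := {ae leb, forall x, D x -> 0 <= u x}.

Definition Xi (g u : R -> R) : Prop :=
  measurable_fun pos u /\ Lone pos (fun x => g x * u x).

Definition L1dist D u v : \bar R := (\int[leb]_(x in D) `|u x - v x|%:E)%E.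

Definition L1_continuous I D F : Prop :=
  (forall t, I t -> Lone D (F t)) /\
  (forall t, I t -> L1dist D (F s) (F t) @[s --> within I (nbhs t)] --> 0%E).

(* C(I; L^1_w(D)); continuity of a map into a weak topology is continuity of
   its composition with every element of the dual L^oo(D). *)
Definition L1w_continuous I D F : Prop :=
  (forall t, I t -> Lone D (F t)) /\
  (forall phi, Linfty D phi ->
     {within I, continuous (fun t => \int[leb]_(x in D) (phi x * F t x))}).

(* F is in C^1(I; L^1(D)) with derivative G (one-sided at an endpoint of I). *)
Definition L1_C1 I D F G : Prop :=
  [/\ L1_continuous I D F,
      L1_continuous I D G &
      forall t, I t ->
        L1dist D (fun x => (F s x - F t x) / (s - t)) (G t)
          @[s --> within I (dnbhs t)] --> 0%E].

(* Convergence in C([0, T']; L^1_w(0, r)). *)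
Definition cvg_L1w (T' r : R) (Fs : nat -> R -> R -> R) F : Prop :=
  forall phi, Linfty `]0, r[ phi ->
    ereal_sup [set `|\int[leb]_(x in `]0, r[) (phi x * (Fs k t x - F t x))|%:E
              | t in `[0, T']] @[k --> \oo] --> 0%E.

Definition mass u : \bar R := (\int[leb]_(x in pos) (x * u x)%:E)%E.

End FunctionSpaces.

Section Coefficients.
Context {R : realType}.

Record collision_kernel (a : R -> R -> R) (A0 : R) (w0 winf : R -> R) : Prop := {
  ck_A0 : 0 < A0;
  ck_w0_ge0 : forall x, 0 <= x -> 0 <= w0 x;
  ck_w0_cont : {within `[0, +oo[, continuous w0};
  ck_w0_homo : {in `[0, +oo[ &, {homo w0 : x y / x <= y}};
  ck_winf_ge0 : forall x, 0 <= x -> 0 <= winf x;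
  ck_winf_cont : {within `[0, +oo[, continuous winf};
  ck_winf_homo : {in `[0, +oo[ &, {homo winf : x y / x <= y}};
  ck_sym : forall x y, 0 < x -> 0 < y -> a x y = a y x;
  ck_ge0 : forall x y, 0 < x -> 0 < y -> 0 <= a x y;
  ck_form : let w x := if x <= 1 then w0 x else winf x in
    forall x y, 0 < x -> 0 < y -> a x y = A0 * w x * w y }.

Record daughter_distribution (b : R -> R -> R -> R) (beta0 p Bp : R) : Prop := {
  dd_meas : measurable_fun (pos `*` pos `*` pos)
    (fun q : R * R * R => b q.1.1 q.1.2 q.2);
  dd_ge0 : forall x y z, 0 < x -> 0 < y -> 0 < z -> 0 <= b x y z;
  dd_mass : forall y z, 0 < y -> 0 < z ->
    (\int[leb]_(x in `]0%R, y[) (x * b x y z)%:E = y%:E)%E;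
  dd_supp : forall x y z, 0 < y -> 0 < z -> y < x -> b x y z = 0;
  dd_beta0 : 2 <= beta0;
  dd_count : forall y z, 0 < y -> 0 < z ->
    (\int[leb]_(x in `]0%R, y[) (b x y z)%:E <= beta0%:E)%E;
  dd_p : 1 < p < 2;
  dd_Bp : 0 < Bp;
  dd_power : forall y z, 0 < y -> 0 < z ->
    (\int[leb]_(x in `]0%R, y[) (b x y z `^ p)%:E
       <= (Bp / 2 * y `^ (1 - p))%:E)%E }.

Record weight_class (b : R -> R -> R -> R) (g : R -> R) : Prop := {
  wc_loc : forall r, 0 < r -> Lone `]0, r[ g;
  wc_gt0 : forall x, 0 < x -> 0 < g x;
  wc_homo : forall x y, 0 < x -> x <= y -> g x / x <= g y / y;
  wc_theta : exists2 theta : R, 0 < theta < 1 &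
    forall y z, 0 < y -> 0 < z ->
      ((theta * g y)%:E
         <= (g y)%:E - \int[leb]_(x in `]0%R, y[) (g x * b x y z)%:E)%E }.

End Coefficients.

Section Solutions.
Context {R : realType}.
Variables (a : R -> R -> R) (b : R -> R -> R -> R) (g fin : R -> R).

Definition psi_tilde (psi : R -> R) (y z : R) : R :=
  \int[leb]_(x in `]0, y[) (psi x * b x y z) - psi y.

(* Weak solution on the time interval I, to be used with I = [0, T) or
   I = [0, T]. *)
Record weak_solution (I : set R) (f : R -> R -> R) : Prop := {
  ws_ge0 : forall t, I t -> ae_nonneg pos (f t);
  ws_cont : L1w_continuous I pos f;
  ws_bounded : exists M : R, {ae leb, forall t, I t ->
    Xi g (f t) /\ (\int[leb]_(x in pos) (g x * `|f t x|)%:E <= M%:E)%E};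
  ws_integrable : forall t, I t -> 0 < t ->
    (leb \x (leb \x leb))%E.-integrable (`]0, t[ `*` (pos `*` pos))
      (fun q : R * (R * R) =>
         (a q.2.1 q.2.2 * f q.1 q.2.1 * f q.1 q.2.2)%:E);
  ws_eq : forall t, I t -> 0 < t -> forall psi, Linfty pos psi ->
    (\int[leb]_(x in pos) (psi x * (f t x - fin x))%:E =
     \int[leb]_(s in `]0%R, t[) \int[leb]_(z in pos) \int[leb]_(y in pos)
       (psi_tilde psi y z * a y z * f s y * f s z)%:E)%E }.

Definition truncated_rhs (n : nat) (u : R -> R) (x : R) : R :=
  \int[leb]_(z in `]0, n%:R[) \int[leb]_(y in `]x, n%:R[)
     (b x y z * a y z * u y * u z)
  - \int[leb]_(y in `]0, n%:R[) (a x y * u x * u y).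

Record truncated_solution (n : nat) (F : R -> R -> R) : Prop := {
  ts_ge0 : forall t, 0 <= t -> ae_nonneg `]0, n%:R[ (F t);
  ts_eq : exists2 G, L1_C1 `[0, +oo[ `]0, n%:R[ F G &
    forall t, 0 <= t ->
      {ae leb, forall x, x \in `]0, n%:R[ -> G t x = truncated_rhs n (F t) x};
  ts_init : {ae leb, forall x, x \in `]0, n%:R[ -> F 0 x = fin x} }.

(* [0, oo) if T = +oo, and the closed interval [0, T] if T is finite. *)
Definition existence_interval (T : \bar R) : set R :=
  [set t : R | 0 <= t /\ (t%:E <= T)%E].

Record constructed_weak_solution (Fs : nat -> R -> R -> R) (T : \bar R)
    (f : R -> R -> R) : Prop := {
  cs_weak : weak_solution (existence_interval T) f;
  cs_limit : exists2 sigma : nat -> nat,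
    {homo sigma : m n / (m < n)%N} &
    forall r T' : R, 1 < r -> 0 < T' -> (T'%:E <= T)%E ->
      cvg_L1w T' r (fun k => Fs (sigma k)) f;
  cs_cont : L1_continuous (existence_interval T) pos f;
  cs_mass : forall t, existence_interval T t -> (mass (f t) <= mass fin)%E }.

End Solutions.

(* Main.v *)
Require Import Defs.
From HB Require Import structures.
From mathcomp Require Import all_boot all_order all_algebra.
From mathcomp Require Import all_classical all_reals all_analysis.
From mathcomp Require Import measurable_realfun lra.

Set Implicit Arguments.
Unset Strict Implicit.
Unset Printing Implicit Defensive.

Import Order.TTheory GRing.Theory Num.Theory.
Import numFieldNormedType.Exports.

Local Open Scope classical_set_scope.
Local Open Scope ring_scope.

(** Everything follows from the weak formulation with two families of bounded
    test functions, together with the fact that the mass of [f t] does not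
    exceed the initial mass.

    Integrability.  Write c = g(k)/k.  Since g(x)/x is non-decreasing,
    h(x) = max(c x - g(x), 0) is bounded, vanishes beyond k and satisfies
    c x - g(x) <= h(x) <= c x.  Breakage conserves the linear part c x, while g
    loses at least the fraction theta in each collision, so psi_tilde h (y, z)
    is at least theta g(y) for y <= k and is nonnegative for y > k
    ([psi_tilde_defect_ge]).  Testing with h bounds theta times the collision
    rate weighted by g(y), y <= k, by the increase of the integral of h f; as
    h <= c x <= h + g and the mass does not grow, this increase is at most the
    integral of g fin ([defect_gain_le]), whatever k is.  Letting k grow gives a
    finite rate with weight g(y) ([weighted_rate_finite]).  Finally
    y <= 1 + g(y)/g(1) and the unweighted rate is finite by the definition of a
    weak solution, which settles the weight y ([mass_rate_finite]).  Testing
    with h rather than with min(g(x), c x) is what keeps the test function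
    bounded.

    Mass conservation.  Since min(x, m)/x is non-increasing, splitting a
    particle cannot decrease the sum of min(x, m) over the fragments
    ([psi_tilde_min_ge0]); hence the integral of min(x, m) f(t, x) is at least
    its initial value, and m -> oo gives mass (f t) >= mass fin, the opposite of
    the assumed inequality.  The weak formulation speaks of positive times only;
    t = 0 is reached by weak continuity.

    Null sets need care: f(s, y) is nonnegative for almost every y, with an
    exceptional set that depends on s, whereas the collision rate is measurable
    jointly.  [iterated_rate_product] turns the iterated integrals of the weak
    formulation into integrals of absolute values over the product space, where
    monotonicity and monotone convergence are available. *)

(** * Tonelli for functions with almost everywhere nonnegative sections *)

(** The product measure under a name of its own, to which the sigma-finite
    structure is attached that an inner factor of an iterated product must
    carry. *)
Definition measure_product d1 d2 (T1 : measurableType d1)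
    (T2 : measurableType d2) (R : realType)
    (m1 : set T1 -> \bar R) (m2 : set T2 -> \bar R) :
  set (T1 * T2)%type -> \bar R := (m1 \x m2)%E.

Section SigmaFiniteProduct.
Context d1 d2 (T1 : measurableType d1) (T2 : measurableType d2) (R : realType).
Variables (m1 : {sigma_finite_measure set T1 -> \bar R})
  (m2 : {sigma_finite_measure set T2 -> \bar R}).
Local Notation mu := (@measure_product _ _ T1 T2 R m1 m2).

HB.instance Definition _ := Measure.copy mu (m1 \x m2)%E.

Let sigma_finite_measure_product : sigma_finite setT mu.
Proof.
have /sigma_finiteP[F [TF ndF Foo]] := sigma_finiteT m1.
have /sigma_finiteP[G [TG ndG Goo]] := sigma_finiteT m2.
exists (fun n => F n `*` G n).
  apply/esym; rewrite -subTset => -[x y] _.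
  have [n _ Fx] : (\bigcup_n F n) x by rewrite -TF.
  have [k _ Gy] : (\bigcup_n G n) y by rewrite -TG.
  exists (maxn n k) => //; split => /=.
  - by move: x Fx; apply/subsetPset/ndF; exact: leq_maxl.
  - by move: y Gy; apply/subsetPset/ndG; exact: leq_maxr.
move=> n; have [mF Fn] := Foo n; have [mG Gn] := Goo n.
split; first exact: measurableX.
by rewrite /measure_product product_measure1E// lte_mul_pinfty// ge0_fin_numE.
Qed.

HB.instance Definition _ := Measure_isSigmaFinite.Build _ _ _ mu
  sigma_finite_measure_product.

End SigmaFiniteProduct.

Lemma ae_imp d (T : measurableType d) (R : realType)
    (mu : {measure set T -> \bar R}) (P Q : T -> Prop) :
  (forall x, P x -> Q x) -> {ae mu, forall x, P x} -> {ae mu, forall x, Q x}.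
Proof. by move=> PQ; apply: (@filterS _ _ (ae_filter_ringOfSetsType mu)). Qed.

Section Tonelli.
Context d1 d2 (T1 : measurableType d1) (T2 : measurableType d2) (R : realType).
Variables (m1 : {sigma_finite_measure set T1 -> \bar R})
  (m2 : {sigma_finite_measure set T2 -> \bar R}).

(** The exceptional null sets may vary with the outer variable, and splitting
    into positive and negative parts avoids having to assemble them: both parts
    have measurable partial integrals, and that of the negative part vanishes
    almost everywhere. *)
Lemma iterated_integral_ae_ge0 (H : T1 * T2 -> \bar R) :
    measurable_fun setT H ->
    {ae m2, forall z, {ae m1, forall y, (0 <= H (y, z))%E}} ->
  (\int[m2]_z \int[m1]_y H (y, z) = \int[m1 \x m2]_q `|H q|)%E.
Proof.
move=> mH H0.
have mHp := measurable_funepos mH.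
have mHn := measurable_funeneg mH.
have mHa : measurable_fun setT (fun q => `|H q|)%E.
  exact: measurableT_comp mH.
rewrite fubini_tonelli2//.
apply: ae_eq_integral => //.
- rewrite (_ : (fun z => \int[m1]_y H (y, z))%E = (fun z =>
    \int[m1]_y H^\+ (y, z) - \int[m1]_y H^\- (y, z))%E); last first.
    apply/funext => z; rewrite integralE.
    by congr (_ - _)%E; apply: eq_integral => y _; rewrite ?funeposE ?funenegE.
  apply: emeasurable_funB.
  + exact: (@measurable_fun_fubini_tonelli_G _ _ _ _ _ m1 H^\+%E).
  + exact: (@measurable_fun_fubini_tonelli_G _ _ _ _ _ m1 H^\-%E).
- exact: (@measurable_fun_fubini_tonelli_G _ _ _ _ _ m1 (fun q => `|H q|)%E).
- move: H0; apply: ae_imp => z Hz _.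
  apply: ae_eq_integral => //.
  + exact: measurable_fun_pair1.
  + exact: (measurable_fun_pair1 (f := fun q => `|H q|%E)).
  + by move: Hz; apply: ae_imp => y Hy _ /=; rewrite gee0_abs.
Qed.

End Tonelli.

Section WeightedRate.
Context d0 d1 d2 (S : measurableType d0) (T1 : measurableType d1)
  (T2 : measurableType d2) (R : realType).
Variables (m0 : {sigma_finite_measure set S -> \bar R})
  (m1 : {sigma_finite_measure set T1 -> \bar R})
  (m2 : {sigma_finite_measure set T2 -> \bar R}).
Variables (D0 : set S) (D1 : set T1) (D2 : set T2).
Hypotheses (mD0 : measurable D0) (mD1 : measurable D1) (mD2 : measurable D2).

Let m12 := measure_product m1 m2.

Let D := D0 `*` (D1 `*` D2).

Let mD : measurable D.
Proof. by apply: measurableX => //; exact: measurableX. Qed.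

Variables (K : S * (T1 * T2) -> R) (W : T1 * T2 -> R).
Hypothesis mK : measurable_fun D K.
Hypothesis mW : measurable_fun (D1 `*` D2) W.
Hypothesis W0 : forall y z, D1 y -> D2 z -> 0 <= W (y, z).
Hypothesis K0 : forall s, D0 s ->
  {ae m2, forall z, D2 z -> {ae m1, forall y, D1 y -> 0 <= K (s, (y, z))}}.

Let H : S * (T1 * T2) -> \bar R := (fun q => (W q.2 * K q)%:E) \_ D.

Let mHT : measurable_fun setT H.
Proof.
apply/(measurable_restrictT _ mD).
apply/measurable_EFinP; apply: measurable_funM => //.
apply: (@measurable_comp _ _ _ _ _ _ (D1 `*` D2)) => //.
- exact: measurableX.
- by move=> _ [[s q] [_ qp]] <-.
- exact: measurable_funTS measurable_snd.
Qed.

Let mHabs : measurable_fun setT (fun q => `|H q|)%E.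
Proof. exact: measurableT_comp mHT. Qed.

Let iterated_rateE s : D0 s ->
  (\int[m2]_(z in D2) \int[m1]_(y in D1) (W (y, z) * K (s, (y, z)))%:E =
   fubini_F m12 (fun q => `|H q|) s)%E.
Proof.
move=> ts; rewrite /fubini_F.
rewrite -(iterated_integral_ae_ge0 (H := fun q => H (s, q))).
- rewrite integral_mkcond; apply: eq_integral => z _.
  rewrite /patch; case: ifPn => [zp|zp].
    rewrite integral_mkcond; apply: eq_integral => y _.
    rewrite /H /patch; congr (if _ then _ else _).
    apply/idP/idP => [yp|]; last by rewrite inE => -[_ [? _]]; rewrite inE.
    by rewrite inE; split => //=; split => /=; rewrite -in_setE.
  rewrite integral0_eq// => y _; rewrite /H /patch ifF//.
  by apply/negP; rewrite inE => -[_ [_ /=]]; rewrite -in_setE (negbTE zp).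
- exact: measurable_fun_pair2.
- have := K0 ts; apply: ae_imp => z Hz.
  have [zp|zp] := pselect (D2 z).
    have := Hz zp; apply: ae_imp => y Hy.
    rewrite /H /patch; case: ifPn => //; rewrite inE => -[_ [/= yp _]].
    by rewrite lee_fin mulr_ge0 ?Hy// W0.
  apply: aeW => y; rewrite /H /patch; case: ifPn => //.
  by rewrite inE => -[_ []].
Qed.

Let H_out s : ~ D0 s -> (fubini_F m12 (fun q => `|H q|) s = 0)%E.
Proof.
move=> nts; rewrite /fubini_F integral0_eq// => q _.
by rewrite /H /patch ifF ?abse0//; apply/negP; rewrite inE => -[].
Qed.

Let rate_integralE :
  (\int[m0 \x m12]_q `|H q| =
   \int[m0 \x m12]_(q in D) (W q.2 * `|K q|)%:E)%E.
Proof.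
rewrite [RHS]integral_mkcond; apply: eq_integral => -[s [y z]] _.
rewrite /H /patch; case: ifPn; last by rewrite abse0.
by rewrite inE => -[_ [/= yp zp]]; rewrite /= normrM ger0_norm// W0.
Qed.

(** The absolute value on the right makes the integrand nonnegative everywhere,
    so that it is monotone in the weight W without any further care. *)
Lemma iterated_rate_product :
  (\int[m0]_(s in D0) \int[m2]_(z in D2) \int[m1]_(y in D1)
     (W (y, z) * K (s, (y, z)))%:E =
   \int[m0 \x measure_product m1 m2]_(q in D0 `*` (D1 `*` D2))
     (W q.2 * `|K q|)%:E)%E.
Proof.
rewrite -rate_integralE fubini_tonelli1//.
rewrite integral_mkcond; apply: eq_integral => s _.
rewrite /patch; case: ifPn => [|/negP]; rewrite inE => ts.
- exact: iterated_rateE.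
- by rewrite H_out.
Qed.

Lemma iterated_rate_integrable :
    (\int[m0 \x measure_product m1 m2]_(q in D0 `*` (D1 `*` D2))
       (W q.2 * `|K q|)%:E < +oo)%E ->
  m0.-integrable D0
    (fun s => \int[m2]_(z in D2) \int[m1]_(y in D1)
       (W (y, z) * K (s, (y, z)))%:E)%E.
Proof.
rewrite -rate_integralE => fin.
apply: (@eq_integrable _ _ _ _ _ mD0
  (fubini_F m12 (fun q => `|H q|))%E).
  by move=> s; rewrite inE => ts; rewrite iterated_rateE.
apply: (@integrableS _ _ _ m0 setT) => //.
apply: integrable_fubini_F; apply/integrableP; split => //.
by under eq_integral do rewrite abse_id.
Qed.

End WeightedRate.

(** * The collision defect of a test function *)

Lemma measurable_pos (R : realType) : measurable (@pos R).
Proof. exact: measurable_itv. Qed.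

Lemma posP (R : realType) (x : R) : pos x <-> 0 < x.
Proof. by rewrite /pos /= in_itv /= andbT. Qed.

Lemma sub_itv0_pos (R : realType) (y : R) : `]0, y[ `<=` pos.
Proof. by move=> x; rewrite /= in_itv /= => /andP[x0 _]; exact/posP. Qed.

Lemma measurable_fun_itv0 (R : realType) (u : R -> R) (y : R) :
  measurable_fun pos u -> measurable_fun `]0, y[ u.
Proof.
move=> mu; apply: (measurable_funS (@measurable_pos R)) mu.
exact: sub_itv0_pos.
Qed.

Section DaughterDistribution.
Context (R : realType).
Variables (b : R -> R -> R -> R) (beta0 p Bp : R).
Hypothesis hb : daughter_distribution b beta0 p Bp.

Lemma measurable_daughter (y z : R) : 0 < y -> 0 < z ->
  measurable_fun `]0, y[ (fun x => b x y z).
Proof.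
move=> y0 z0; apply: measurable_fun_itv0.
apply: (@measurable_comp _ _ _ _ _ _ (pos `*` pos `*` pos)
  (fun q : R * R * R => b q.1.1 q.1.2 q.2) pos (fun x => (x, y, z))).
- by apply: measurableX; [apply: measurableX|]; exact: measurable_pos.
- by move=> _ [x xp <-]; split; [split|]; rewrite //=; exact/posP.
- exact: dd_meas hb.
- by apply: measurable_funTS; apply: measurable_fun_pair => //;
    exact: measurable_fun_pair.
Qed.

Section TestFunction.
Variables (h : R -> R) (M : R).
Hypotheses (mh : measurable_fun pos h) (h0 : forall x, 0 < x -> 0 <= h x)
  (hM : forall x, 0 < x -> h x <= M).

Let mh_b (y z : R) : 0 < y -> 0 < z ->
  measurable_fun `]0, y[ (fun x => h x * b x y z).
Proof.
move=> y0 z0; apply: measurable_funM; last exact: measurable_daughter.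
exact: measurable_fun_itv0.
Qed.

(** The gain is at most M times the bound beta0 on the number of fragments. *)
Lemma gain_fin_num (y z : R) : 0 < y -> 0 < z ->
  (\int[leb]_(x in `]0%R, y[) (h x * b x y z)%:E)%E \is a fin_num.
Proof.
move=> y0 z0.
have M0 : 0 <= M by apply: le_trans (h0 ltr01) (hM ltr01).
have hb0 x : `]0, y[%classic x -> 0 <= b x y z.
  by rewrite /= in_itv /= => /andP[x0 _]; exact: dd_ge0 hb _ _ _ _ _ _.
have hx0 x : `]0, y[%classic x -> 0 <= h x.
  by rewrite /= in_itv /= => /andP[x0 _]; exact: h0.
rewrite ge0_fin_numE; last first.
  by apply: integral_ge0 => x xy; rewrite lee_fin mulr_ge0// ?hb0 ?hx0.
apply: (@le_lt_trans _ _ (\int[leb]_(x in `]0%R, y[) (M%:E * (b x y z)%:E))%E).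
  apply: ge0_le_integral => //.
  - by move=> x xy; rewrite lee_fin mulr_ge0// ?hb0 ?hx0.
  - by apply/measurable_EFinP; exact: mh_b.
  - apply/measurable_EFinP; apply: measurable_funM => //.
    exact: measurable_daughter.
  - move=> x xy; rewrite lee_fin ler_wpM2r ?hb0//.
    by move: xy; rewrite /= in_itv /= => /andP[x0 _]; exact: hM.
rewrite ge0_integralZl//.
- by apply: le_lt_trans (ltry (M * beta0)); rewrite EFinM lee_wpmul2l//
    (dd_count hb).
- by apply/measurable_EFinP; exact: measurable_daughter.
Qed.

Lemma psi_tildeE (y z : R) : 0 < y -> 0 < z ->
  ((psi_tilde b h y z)%:E =
   \int[leb]_(x in `]0%R, y[) (h x * b x y z)%:E - (h y)%:E)%E.
Proof.
by move=> y0 z0; rewrite /psi_tilde /Rintegral EFinB fineK// gain_fin_num.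
Qed.

(** Since the upper limit of the gain integral is one of the free variables, it
    is absorbed in the domain E of an integrand on the product space before
    Tonelli applies. *)
Lemma measurable_psi_tilde :
  measurable_fun (pos `*` pos) (fun q => psi_tilde b h q.1 q.2).
Proof.
pose E : set (R * (R * R)) :=
  (pos `*` (pos `*` pos)) `&` (fun q => q.2.1 - q.1) @^-1` pos.
have mX : measurable (@pos R `*` (@pos R `*` @pos R)).
  by apply: measurableX; [|apply: measurableX]; exact: measurable_pos.
have mE : measurable E.
  have mf : measurable_fun setT (fun q : R * (R * R) => q.2.1 - q.1).
    apply: measurable_funB => //.
    exact: measurableT_comp.
  by apply: measurableI => //; rewrite -[X in measurable X]setTI;
    apply: mf => //; exact: measurable_pos.
pose G : R * (R * R) -> \bar R :=
  (fun q => (h q.1 * b q.1 q.2.1 q.2.2)%:E) \_ E.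
have G0 q : (0 <= G q)%E.
  rewrite /G /patch; case: ifPn => //.
  rewrite inE => -[[/posP x0 [/posP y0 /posP z0]] _].
  rewrite lee_fin mulr_ge0 ?h0//.
  exact: dd_ge0 hb _ _ _ _ _ _.
have mG : measurable_fun setT G.
  apply/(measurable_restrictT _ mE)/measurable_EFinP.
  apply: (@measurable_funS _ _ _ _ _ E _ mX) => //; first by move=> q [].
  apply: measurable_funM.
    apply: (@measurable_comp _ _ _ _ _ _ pos) => //.
    - exact: measurable_pos.
    - by move=> _ [q [? _] <-].
    - exact: measurable_funTS.
  apply: (@measurable_comp _ _ _ _ _ _ (pos `*` pos `*` pos)
    (fun q : R * R * R => b q.1.1 q.1.2 q.2) (pos `*` (pos `*` pos))
    (fun q : R * (R * R) => (q.1, q.2.1, q.2.2))).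
  - by apply: measurableX; [apply: measurableX|]; exact: measurable_pos.
  - by move=> _ [q [? [? ?]] <-].
  - exact: dd_meas hb.
  - apply: measurable_funTS; apply: measurable_fun_pair.
      apply: measurable_fun_pair => //; exact: measurableT_comp.
    exact: measurableT_comp.
apply: measurable_funB; last first.
  apply: (@measurable_comp _ _ _ _ _ _ pos) => //.
  - exact: measurable_pos.
  - by move=> _ [q [? _] <-].
  - exact: measurable_funTS.
have mGG : measurable_fun (pos `*` pos) (fine \o fubini_G leb G).
  apply: measurable_funTS; apply: measurableT_comp.
    exact: fine_measurable.
  exact: measurable_fun_fubini_tonelli_G.
apply: eq_measurable_fun mGG => -[y z]; rewrite inE => -[/= /posP y0 /posP z0].
rewrite /fubini_G /Rintegral [in RHS]integral_mkcond; congr fine.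
apply: eq_integral => x _; rewrite /G /patch; congr (if _ then _ else _).
apply/idP/idP; rewrite !inE /= in_itv /=.
  by move=> [[/posP /= -> _]] /posP /=; rewrite subr_gt0.
by move=> /andP[x0 xy]; split; [split; [|split]|]; apply/posP => //=;
  rewrite subr_gt0.
Qed.

End TestFunction.
End DaughterDistribution.

(** * The two families of test functions *)

Section TestFunctions.
Context (R : realType).
Variables (b : R -> R -> R -> R) (beta0 p Bp : R).
Hypothesis hb : daughter_distribution b beta0 p Bp.

Lemma measurable_minr_cst (m : R) :
  measurable_fun pos (fun x : R => Num.min x m).
Proof. exact: measurable_minr. Qed.

(** Breakage splits y into pieces of total mass y and size at most y, and
    min(x, m) / x is non-increasing in x, so that min(x, m) >= (min(y, m)/y) x
    on each piece. *)
Lemma psi_tilde_min_ge0 (m y z : R) : 0 < m -> 0 < y -> 0 < z ->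
  0 <= psi_tilde b (Num.min^~ m) y z.
Proof.
move=> m0 y0 z0.
have hx0 (x : R) : 0 < x -> 0 <= Num.min x m by move=> x0; rewrite le_min !ltW.
have hm (x : R) : 0 < x -> Num.min x m <= m.
  by move=> _; rewrite ge_min lexx orbT.
rewrite -lee_fin (psi_tildeE hb (measurable_minr_cst m) hx0 hm)// sube_ge0//.
have mb := measurable_daughter hb y0 z0.
have x0 (x : R) : `]0, y[%classic x -> 0 < x by move/(@sub_itv0_pos R)/posP.
have b0 (x : R) : `]0, y[%classic x -> 0 <= b x y z.
  by move/x0 => ?; exact: dd_ge0 hb _ _ _ _ _ _.
have c0 : 0 <= Num.min y m / y by rewrite divr_ge0 ?hx0// ltW.
have -> : (Num.min y m)%:E = (\int[leb]_(x in `]0%R, y[)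
    ((Num.min y m / y)%:E * (x * b x y z)%:E))%E.
  rewrite ge0_integralZl//.
  - by rewrite (dd_mass hb)// -EFinM divfK// gt_eqF.
  - by apply/measurable_EFinP; exact: measurable_funM.
  - by move=> x xy; rewrite lee_fin mulr_ge0 ?b0// ltW// x0.
apply: ge0_le_integral => //.
- move=> x xy; rewrite -EFinM lee_fin mulr_ge0// mulr_ge0 ?b0//.
  exact/ltW/x0.
- by apply/measurable_EFinP; do 2!apply: measurable_funM => //.
- apply/measurable_EFinP; apply: measurable_funM => //.
  exact: measurable_fun_itv0 (measurable_minr_cst m).
- move=> x xy; rewrite -EFinM lee_fin mulrA ler_wpM2r ?b0//.
  have := xy; rewrite /= in_itv /= => /andP[x_gt0 xley].
  rewrite le_min; apply/andP; split.
    by rewrite mulrAC ler_pdivrMr// mulrC ler_wpM2l ?(ltW x_gt0)// ge_min lexx.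
  rewrite mulrAC ler_pdivrMr// ler_pM ?hx0 ?(ltW x_gt0)// ?(ltW xley)//.
  exact: hm.
Qed.

Variable g : R -> R.
Hypothesis hg : weight_class b g.

Lemma measurable_weight : measurable_fun pos g.
Proof.
have -> : @pos R = \bigcup_n `]0%R, n.+1%:R[%classic.
  apply/seteqP; split => [x /posP x0|x [n _]]; last exact: sub_itv0_pos.
  exists (Num.truncn x) => //=; rewrite in_itv /= x0.
  by apply: truncnS_gt.
apply/measurable_fun_bigcup => // n.
by apply/measurable_EFinP; apply: measurable_int (wc_loc hg _).
Qed.

Let g0 x : 0 < x -> 0 < g x. Proof. exact: (wc_gt0 hg). Qed.

(** This is c x - min(g(x), c x) with c = g(k)/k: up to the linear part, which
    breakage conserves, testing with it is testing with the opposite of the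
    truncated weight min(g(x), c x). *)
Definition weight_defect (k x : R) : R := Num.max (g k / k * x - g x) 0.

Lemma weight_defect_ge0 k x : 0 <= weight_defect k x.
Proof. by rewrite /weight_defect le_max lexx orbT. Qed.

Lemma measurable_weight_defect k : measurable_fun pos (weight_defect k).
Proof.
apply: measurable_maxr => //; apply: measurable_funB.
  exact: measurable_funM.
exact: measurable_weight.
Qed.

Lemma weight_defect_low k x : 0 < x -> x <= k ->
  weight_defect k x = g k / k * x - g x.
Proof.
move=> x0 xk; rewrite /weight_defect; apply/max_idPl; rewrite subr_ge0.
by rewrite -ler_pdivrMr// (wc_homo hg).
Qed.

Lemma weight_defect_high k x : 0 < k -> k <= x -> weight_defect k x = 0.
Proof.
move=> k0 kx; have x0 := lt_le_trans k0 kx.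
rewrite /weight_defect; apply/max_idPr; rewrite subr_le0.
by rewrite -ler_pdivlMr// (wc_homo hg).
Qed.

Lemma linear_le_defect k x : g k / k * x <= weight_defect k x + g x.
Proof. by rewrite -lerBlDr /weight_defect le_max lexx. Qed.

Lemma weight_defect_le k x : 0 < k -> 0 < x -> weight_defect k x <= g k.
Proof.
move=> k0 x0; case: (leP x k) => xk; last first.
  by rewrite weight_defect_high ?ltW ?g0.
rewrite weight_defect_low// lerBlDr (le_trans (y := g k))//.
  by rewrite mulrAC ler_pdivrMr// ler_wpM2l// ltW// g0.
by rewrite lerDl ltW// g0.
Qed.

(** From c x <= h(x) + g(x), with h the defect function, the gain of h is at
    least c y minus the gain of g, that is at least c y - (1 - theta) g(y); for
    y <= k the loss h(y) is exactly c y - g(y).  For y > k there is no loss. *)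
Lemma psi_tilde_defect_ge (k theta y z : R) : 0 < k -> 0 < theta ->
    (forall y z, 0 < y -> 0 < z -> ((theta * g y)%:E <=
       (g y)%:E - \int[leb]_(x in `]0%R, y[) (g x * b x y z)%:E)%E) ->
    0 < y -> 0 < z ->
  (if y <= k then theta * g y else 0) <= psi_tilde b (weight_defect k) y z.
Proof.
move=> k0 th0 hth y0 z0.
have mh := measurable_weight_defect k.
have hM x : 0 < x -> weight_defect k x <= g k by exact: weight_defect_le.
have h0 x : 0 < x -> 0 <= weight_defect k x.
  by move=> _; exact: weight_defect_ge0.
have mb := measurable_daughter hb y0 z0.
have x0 (x : R) : `]0, y[%classic x -> 0 < x by move/(@sub_itv0_pos R)/posP.
have b0 (x : R) : `]0, y[%classic x -> 0 <= b x y z.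
  by move/x0 => ?; exact: dd_ge0 hb _ _ _ _ _ _.
have Jfin := gain_fin_num hb mh h0 hM y0 z0.
rewrite -lee_fin (psi_tildeE hb mh h0 hM)//.
case: ifPn => [yk|]; last first.
  rewrite -ltNge => /ltW ky; rewrite weight_defect_high// sube0.
  apply: integral_ge0 => x xy.
  by rewrite lee_fin mulr_ge0 ?weight_defect_ge0 ?b0.
have mgb : measurable_fun `]0, y[ (fun x => g x * b x y z).
  apply: measurable_funM => //.
  exact: measurable_fun_itv0 measurable_weight.
have mhb : measurable_fun `]0, y[ (fun x => weight_defect k x * b x y z).
  apply: measurable_funM => //.
  exact: measurable_fun_itv0 mh.
have c0 : 0 <= g k / k by rewrite divr_ge0// ltW// g0.
have lin : ((g k / k * y)%:E <=
    \int[leb]_(x in `]0%R, y[) (weight_defect k x * b x y z)%:E +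
    \int[leb]_(x in `]0%R, y[) (g x * b x y z)%:E)%E.
  rewrite -ge0_integralD//=; first last.
  - exact/measurable_EFinP.
  - by move=> x xy; rewrite lee_fin mulr_ge0 ?b0//; exact/ltW/g0/x0.
  - exact/measurable_EFinP.
  - by move=> x xy; rewrite lee_fin mulr_ge0 ?weight_defect_ge0 ?b0.
  rewrite EFinM -(dd_mass hb y0 z0) -ge0_integralZl//; first last.
  - by move=> x xy; rewrite lee_fin mulr_ge0 ?b0//; exact/ltW/x0.
  - by apply/measurable_EFinP; exact: measurable_funM.
  apply: ge0_le_integral => //.
  - move=> x xy; rewrite -EFinM lee_fin mulr_ge0// mulr_ge0 ?b0//.
    exact/ltW/x0.
  - by apply/measurable_EFinP; do 2!apply: measurable_funM => //.
  - by apply/measurable_EFinP; exact: measurable_funD.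
  - move=> x xy; rewrite -EFinM -EFinD lee_fin mulrA -mulrDl ler_wpM2r ?b0//.
    exact: linear_le_defect.
have G0 : (0 <= \int[leb]_(x in `]0%R, y[) (g x * b x y z)%:E)%E.
  apply: integral_ge0 => x xy; rewrite lee_fin mulr_ge0 ?b0//.
  exact/ltW/g0/x0.
rewrite weight_defect_low//.
move: (hth y z y0 z0) lin G0 Jfin.
case: (\int[leb]_(x in _) (g x * _)%:E)%E => [G| |]//.
case: (\int[leb]_(x in _) _)%E => [J| |]//.
rewrite -!EFinB -!EFinD !lee_fin => H1 H2 _ _; lra.
Qed.

End TestFunctions.

(** * Truncated masses *)

(** Monotone convergence in the form that truncations call for: at each point
    the approximations are eventually equal to the limit. *)
Lemma integral_le_exhaustion d (T : measurableType d) (R : realType)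
    (mu : {measure set T -> \bar R}) (D : set T)
    (F : nat -> T -> R) (G : T -> R) (B : \bar R) :
    measurable D -> (forall n, measurable_fun D (F n)) ->
    (forall n x, D x -> 0 <= F n x) ->
    (forall x, D x -> {homo F^~ x : n m / (n <= m)%N >-> n <= m}) ->
    (forall x, D x -> \forall n \near \oo, F n x = G x) ->
    (forall n, \int[mu]_(x in D) (F n x)%:E <= B)%E ->
  (\int[mu]_(x in D) (G x)%:E <= B)%E.
Proof.
move=> mD mF F0 ndF FG FB.
rewrite (eq_integral (fun x => limn (fun n => (F n x)%:E))); last first.
  move=> x; rewrite inE => Dx; apply/esym/cvg_lim => //.
  apply: cvg_near_cst; move: (FG x Dx); apply: filterS => n ->//.
rewrite monotone_convergence//; last by move=> n; exact/measurable_EFinP.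
apply: lime_le; last by apply: nearW.
apply: ereal_nondecreasing_is_cvgn => n m nm; apply: ge0_le_integral => //.
- by move=> x Dx; rewrite lee_fin F0.
- exact/measurable_EFinP.
- exact/measurable_EFinP.
- by move=> x Dx; rewrite lee_fin ndF.
Qed.

Lemma near_le_natS (R : realType) (x : R) : \forall n \near \oo, x <= n.+1%:R.
Proof.
exists (Num.truncn x) => // n /= xn.
by rewrite ltW// (lt_le_trans (truncnS_gt x))// ler_nat.
Qed.

Section Masses.
Context (R : realType).
Implicit Types u h : R -> R.

Lemma Lone_measurable (D : set R) u : Lone D u -> measurable_fun D u.
Proof. by move=> iu; apply/measurable_EFinP; apply: measurable_int iu. Qed.

Lemma integral_ae_nonneg_abs u h : Lone pos u -> ae_nonneg pos u ->
    measurable_fun pos h ->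
  (\int[leb]_(x in pos) (h x * u x)%:E =
   \int[leb]_(x in pos) (h x * `|u x|)%:E)%E.
Proof.
move=> /Lone_measurable mu u0 mh; apply: ae_eq_integral => //.
- exact: measurable_pos.
- by apply/measurable_EFinP; exact: measurable_funM.
- apply/measurable_EFinP; apply: measurable_funM => //.
  exact: measurableT_comp mu.
- by move: u0; apply: ae_imp => x u0 Dx; rewrite ger0_norm// u0.
Qed.

Lemma integrable_bounded_test u h (M : R) :
    Lone pos u -> measurable_fun pos h ->
    (forall x, 0 < x -> `|h x| <= M) ->
  leb.-integrable pos (fun x => (h x * u x)%:E).
Proof.
move=> iu mh hM.
have mu : measurable_fun pos u by exact: Lone_measurable iu.
apply: (@le_integrable _ _ _ leb _ (@measurable_pos R) _
  (fun x => M%:E * (u x)%:E)%E).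
- by apply/measurable_EFinP; exact: measurable_funM.
- move=> x /posP x0; rewrite -EFinM !abse_EFin lee_fin !normrM ler_wpM2r//.
  by rewrite (le_trans (hM _ x0))// ler_norm.
- by apply: integrableZl => //; exact: measurable_pos.
Qed.

Lemma mass_le_of_min u (B : \bar R) : Lone pos u -> ae_nonneg pos u ->
    (forall m : R, 0 < m ->
      (\int[leb]_(x in pos) (Num.min x m * `|u x|)%:E <= B)%E) ->
  (mass u <= B)%E.
Proof.
move=> iu u0 H; rewrite /mass (integral_ae_nonneg_abs (h := id))//.
have mu : measurable_fun pos u by exact: Lone_measurable iu.
apply: (@integral_le_exhaustion _ _ _ leb _
  (fun n x => Num.min x n.+1%:R * `|u x|)) => //.
- exact: measurable_pos.
- move=> n; apply: measurable_funM; last exact: measurableT_comp mu.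
  exact: measurable_minr_cst.
- by move=> n x /posP x0; rewrite mulr_ge0// le_min ler0n ltW.
- move=> x /posP x0 n m nm; rewrite ler_wpM2r//.
  by rewrite le_min !ge_min lexx/= ler_nat ltnS nm orbT.
- move=> x _; have := near_le_natS x; apply: filterS => n xn.
  by rewrite (min_idPl xn).
- by move=> n; exact: H.
Qed.

Lemma min_le_mass u (m : R) : Lone pos u -> ae_nonneg pos u -> 0 < m ->
  (\int[leb]_(x in pos) (Num.min x m * `|u x|)%:E <= mass u)%E.
Proof.
move=> iu u0 m0; rewrite /mass (integral_ae_nonneg_abs (h := id))//.
have mu : measurable_fun pos u by exact: Lone_measurable iu.
have mau : measurable_fun pos (fun x => `|u x|) by exact: measurableT_comp mu.
apply: ge0_le_integral.
- exact: measurable_pos.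
- by move=> x /posP x0; rewrite lee_fin mulr_ge0// le_min !ltW.
- apply/measurable_EFinP; apply: measurable_funM => //.
  exact: measurable_minr_cst.
- by apply/measurable_EFinP; exact: measurable_funM.
- by move=> x /posP x0; rewrite lee_fin ler_wpM2r// ge_min lexx.
Qed.

End Masses.

(** * A priori estimates for weak solutions *)

Section CollisionRate.
Context (R : realType).

Definition cylinder (t : R) : set (R * (R * R)) := `]0, t[ `*` (pos `*` pos).

Definition collision_rate (a f : R -> R -> R) (q : R * (R * R)) : R :=
  a q.2.1 q.2.2 * f q.1 q.2.1 * f q.1 q.2.2.

End CollisionRate.

Section WeakSolutionEstimates.
Context (R : realType).
Variables (a : R -> R -> R) (b : R -> R -> R -> R) (beta0 p Bp : R).
Hypothesis hb : daughter_distribution b beta0 p Bp.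
Hypothesis a_ge0 : forall x y, 0 < x -> 0 < y -> 0 <= a x y.
Variables (g fin : R -> R).
Hypotheses (ifin : Lone pos fin) (fin0 : ae_nonneg pos fin).
Variables (I : set R) (f : R -> R -> R).
Hypothesis hf : weak_solution a b g fin I f.
Variable t : R.
Hypotheses (It : I t) (t0 : 0 < t) (sI : `]0, t[ `<=` I).

Local Notation K := (collision_rate a f).

Let mt : measurable (`]0, t[%classic : set R).
Proof. exact: measurable_itv. Qed.

Let mK : measurable_fun (cylinder t) K.
Proof.
by apply/measurable_EFinP; apply: measurable_int (ws_integrable hf It t0).
Qed.

Let K0 s : `]0, t[%classic s ->
  {ae leb, forall z, pos z -> {ae leb, forall y, pos y -> 0 <= K (s, (y, z))}}.
Proof.
move=> /sI /(ws_ge0 hf) f0; move: (f0); apply: ae_imp => z fz zp.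
move: f0; apply: ae_imp => y fy yp.
have /posP y0 := yp; have /posP z0 := zp.
by rewrite /collision_rate /= !mulr_ge0 ?fy ?fz ?a_ge0.
Qed.

Lemma weak_rate_product (W : R * R -> R) : measurable_fun (pos `*` pos) W ->
    (forall y z, pos y -> pos z -> 0 <= W (y, z)) ->
  (\int[leb]_(s in `]0%R, t[) \int[leb]_(z in pos) \int[leb]_(y in pos)
     (W (y, z) * a y z * f s y * f s z)%:E =
   \int[leb \x measure_product leb leb]_(q in cylinder t)
     (W q.2 * `|collision_rate a f q|)%:E)%E.
Proof.
move=> mW W0.
have := iterated_rate_product (m1 := leb) (m2 := leb) leb mt (@measurable_pos R)
  (@measurable_pos R) mK mW W0 K0.
move=> <-; apply: eq_integral => s _; apply: eq_integral => z _.
by apply: eq_integral => y _; rewrite /collision_rate /= !mulrA.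
Qed.

Lemma weak_rate_integrable (W : R * R -> R) : measurable_fun (pos `*` pos) W ->
    (forall y z, pos y -> pos z -> 0 <= W (y, z)) ->
    (\int[leb \x measure_product leb leb]_(q in cylinder t)
       (W q.2 * `|collision_rate a f q|)%:E < +oo)%E ->
  leb.-integrable `]0, t[
    (fun s => \int[leb]_(z in pos) \int[leb]_(y in pos)
       (W (y, z) * a y z * f s y * f s z)%:E)%E.
Proof.
move=> mW W0 fin_rate.
have := iterated_rate_integrable (m0 := leb) (m1 := leb) (m2 := leb) mt
  (@measurable_pos R) (@measurable_pos R) mK mW W0 K0 fin_rate.
apply: eq_integrable => //.
move=> s _ /=; apply: eq_integral => z _.
by apply: eq_integral => y _; rewrite /collision_rate /= !mulrA.
Qed.

(** The sign of the collision defect allows the weak formulation to be written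
    with absolute values throughout, as an identity in the extended reals whose
    last term is a genuine nonnegative gain. *)
Lemma weak_balance (h : R -> R) (M : R) : measurable_fun pos h ->
    (forall x, 0 < x -> 0 <= h x) -> (forall x, 0 < x -> h x <= M) ->
    (forall y z, 0 < y -> 0 < z -> 0 <= psi_tilde b h y z) ->
  (\int[leb]_(x in pos) (h x * `|f t x|)%:E =
   \int[leb]_(x in pos) (h x * `|fin x|)%:E +
   \int[leb \x measure_product leb leb]_(q in cylinder t)
     (psi_tilde b h q.2.1 q.2.2 *
        `|collision_rate a f q|)%:E)%E.
Proof.
move=> mh h0 hM psi0.
have ift : Lone pos (f t) by exact: (ws_cont hf).1.
have ft0 := ws_ge0 hf It.
have hM' x : 0 < x -> `|h x| <= M by move=> x0; rewrite ger0_norm ?h0// hM.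
have Lh : Linfty pos h.
  by split=> //; exists M; apply: aeW => x /posP; exact: hM'.
have i1 := integrable_bounded_test ift mh hM'.
have i2 := integrable_bounded_test ifin mh hM'.
have := ws_eq hf It t0 Lh.
have psi0' y z : pos y -> pos z -> 0 <= psi_tilde b h y z.
  by move=> /posP y0 /posP z0; exact: psi0.
rewrite (weak_rate_product (measurable_psi_tilde hb mh h0) psi0') => <-.
rewrite -!integral_ae_nonneg_abs//.
have -> : (\int[leb]_(x in pos) (h x * (f t x - fin x))%:E =
    \int[leb]_(x in pos) (h x * f t x)%:E -
    \int[leb]_(x in pos) (h x * fin x)%:E)%E.
  rewrite -(@integralB _ _ R leb _ (@measurable_pos R) _ _ i1 i2).
  by apply: eq_integral => x _; rewrite /= mulrBr EFinB.
rewrite addeC subeK//.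
exact: (@integrable_fin_num _ _ R leb _ (@measurable_pos R) _ i2).
Qed.

Lemma mass_min_nondecreasing (m : R) : 0 < m ->
  (\int[leb]_(x in pos) (Num.min x m * `|fin x|)%:E <=
   \int[leb]_(x in pos) (Num.min x m * `|f t x|)%:E)%E.
Proof.
move=> m0; rewrite (@weak_balance (Num.min^~ m) m).
- rewrite leeDl//; apply: integral_ge0 => -[s [y z]] [_ [/posP y0 /posP z0]].
  by rewrite lee_fin mulr_ge0//; exact: psi_tilde_min_ge0 hb _ _ _ m0 y0 z0.
- exact: measurable_minr_cst.
- by move=> x x0; rewrite le_min !ltW.
- by move=> x _; rewrite ge_min lexx orbT.
- by move=> y z y0 z0; exact: psi_tilde_min_ge0 hb _ _ _ m0 y0 z0.
Qed.

Hypothesis hmass : (mass (f t) <= mass fin)%E.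
Hypotheses (hg : weight_class b g) (gfin : Lone pos (fun x => g x * fin x)).

Let mfin : measurable_fun pos fin.
Proof. exact: Lone_measurable ifin. Qed.

Let mf : measurable_fun pos (f t).
Proof. exact: Lone_measurable ((ws_cont hf).1 t It). Qed.

(** With h the defect function and c = g(k)/k, the chain is
    int h f(t) <= c mass (f t) <= c mass fin <= int h fin + int g fin, the outer
    steps being h <= c x <= h + g. *)
Lemma defect_gain_le (k : R) : 0 < k ->
    (forall y z, 0 < y -> 0 < z -> 0 <= psi_tilde b (weight_defect g k) y z) ->
  (\int[leb \x measure_product leb leb]_(q in cylinder t)
     (psi_tilde b (weight_defect g k) q.2.1 q.2.2 *
        `|collision_rate a f q|)%:E
   <= \int[leb]_(x in pos) (g x * `|fin x|)%:E)%E.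
Proof.
move=> k0 psi0.
have ift : Lone pos (f t) by exact: (ws_cont hf).1.
have g0 x : 0 < x -> 0 < g x by exact: (wc_gt0 hg).
have c0 : 0 <= g k / k by rewrite divr_ge0// ltW// g0.
have mh := measurable_weight_defect hg k.
have h0 x : 0 < x -> 0 <= weight_defect g k x.
  by move=> _; exact: weight_defect_ge0.
have hM x : 0 < x -> weight_defect g k x <= g k.
  exact: (weight_defect_le hg k0).
have B := weak_balance mh h0 hM psi0.
have mafin : measurable_fun pos (fun x => `|fin x|).
  exact: measurableT_comp mfin.
have maf : measurable_fun pos (fun x => `|f t x|) by exact: measurableT_comp mf.
have mg := measurable_weight hg.
have mp := @measurable_pos R.
have upper : (\int[leb]_(x in pos) (weight_defect g k x * `|f t x|)%:E <=
    \int[leb]_(x in pos) (weight_defect g k x * `|fin x|)%:E +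
    \int[leb]_(x in pos) (g x * `|fin x|)%:E)%E.
  apply: (@le_trans _ _ ((g k / k)%:E * mass (f t))%E).
    rewrite /mass (integral_ae_nonneg_abs (h := id) ift (ws_ge0 hf It))//.
    rewrite -ge0_integralZl//; first last.
    - by move=> x /posP x0; rewrite lee_fin mulr_ge0// ltW.
    - by apply/measurable_EFinP; exact: measurable_funM.
    apply: ge0_le_integral => //.
    - by move=> x /posP x0; rewrite lee_fin mulr_ge0// h0.
    - by apply/measurable_EFinP; exact: measurable_funM.
    - by apply/measurable_EFinP; do 2!apply: measurable_funM => //.
    - move=> x /posP x0; rewrite -EFinM lee_fin mulrA ler_wpM2r//.
      rewrite /weight_defect ge_max lerBlDr lerDl ltW ?g0//=.
      by rewrite mulr_ge0// ltW.
  apply: (@le_trans _ _ ((g k / k)%:E * mass fin)%E); first exact: lee_wpmul2l.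
  rewrite /mass (integral_ae_nonneg_abs (h := id) ifin fin0)//.
  rewrite -ge0_integralZl//; first last.
  - by move=> x /posP x0; rewrite lee_fin mulr_ge0// ltW.
  - by apply/measurable_EFinP; exact: measurable_funM.
  rewrite -ge0_integralD//; first last.
  - by apply/measurable_EFinP; exact: measurable_funM.
  - by move=> x /posP x0; rewrite lee_fin mulr_ge0// ltW// g0.
  - by apply/measurable_EFinP; exact: measurable_funM.
  - by move=> x /posP x0; rewrite lee_fin mulr_ge0// h0.
  apply: ge0_le_integral => //.
  - by move=> x /posP x0; rewrite -EFinM lee_fin mulr_ge0// mulr_ge0// ltW.
  - by apply/measurable_EFinP; do 2!apply: measurable_funM => //.
  - by apply/measurable_EFinP; apply: measurable_funD; exact: measurable_funM.
  - move=> x /posP x0; rewrite -EFinM -EFinD lee_fin mulrA -mulrDl ler_wpM2r//.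
    exact: linear_le_defect.
move: upper; rewrite B leeD2lE//.
rewrite -(integral_ae_nonneg_abs ifin fin0 mh).
apply: integrable_fin_num => //.
apply: (@integrable_bounded_test _ _ _ (g k)) => //.
by move=> x x0; rewrite ger0_norm ?h0// hM.
Qed.

Let mcyl : measurable (cylinder t).
Proof. by do 2!apply: measurableX => //; exact: measurable_pos. Qed.

Let mabsK : measurable_fun (cylinder t) (fun q => `|K q|).
Proof. exact: measurableT_comp mK. Qed.

Let measurable_on_cylinder (u : R -> R) : measurable_fun pos u ->
  measurable_fun (cylinder t) (fun q => u q.2.1).
Proof.
move=> mu.
apply: (@measurable_comp _ _ _ _ _ _ pos u (cylinder t) (fun q => q.2.1)) => //.
- exact: measurable_pos.
- by move=> _ [q [_ [? _]] <-].
- by apply: measurable_funTS; exact: measurableT_comp.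
Qed.

(** The bound on the truncated rates does not depend on the truncation level, so
    monotone convergence applies along k = n + 1. *)
Lemma weighted_rate_finite :
  (\int[leb \x measure_product leb leb]_(q in cylinder t)
     (g q.2.1 * `|K q|)%:E < +oo)%E.
Proof.
have [theta /andP[th0 _] hth] := wc_theta hg.
have g0 x : 0 < x -> 0 < g x by exact: (wc_gt0 hg).
have mg := measurable_weight hg.
pose W k y := if y <= k then theta * g y else 0.
have mW k : measurable_fun pos (W k).
  rewrite (_ : W k = fun y => theta * g y * \1_`]-oo, k] y); last first.
    apply/funext => y; rewrite /W indicE; case: ifPn => yk.
      by rewrite mem_set ?mulr1//= in_itv.
    by rewrite memNset ?mulr0//= in_itv/= (negbTE yk).
  by do 2!apply: measurable_funM => //.
have W0 k y : 0 < y -> 0 <= W k y.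
  move=> y0; rewrite /W; case: ifP => // _.
  by rewrite mulr_ge0 ?(ltW th0)// ltW// g0.
have psi_ge (k y z : R) : 0 < k -> 0 < y -> 0 < z ->
    W k y <= psi_tilde b (weight_defect g k) y z.
  by move=> k0 y0 z0; exact: (psi_tilde_defect_ge hb hg).
have bound : (\int[leb \x measure_product leb leb]_(q in cylinder t)
    (theta * g q.2.1 * `|K q|)%:E <=
    \int[leb]_(x in pos) (g x * `|fin x|)%:E)%E.
  apply: (@integral_le_exhaustion _ _ _ (leb \x measure_product leb leb)%E
    (cylinder t)
    (fun n q => W n.+1%:R q.2.1 * `|K q|)) => //.
  - by move=> n; apply: measurable_funM => //; exact: measurable_on_cylinder.
  - by move=> n q [_ [/posP y0 _]]; rewrite mulr_ge0// W0.
  - move=> q [_ [/posP y0 _]] n m nm; rewrite ler_wpM2r// /W.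
    case: ifPn => yn; last first.
      by case: ifP => // _; rewrite mulr_ge0 ?(ltW th0)// ltW// g0.
    by rewrite ifT// (le_trans yn)// ler_nat.
  - move=> q _; have := near_le_natS q.2.1; apply: filterS => n yn.
    by rewrite /W yn.
  - move=> n; have n0 : 0 < n.+1%:R :> R by rewrite ltr0n.
    apply: le_trans (defect_gain_le n0 _); last first.
      by move=> y z y0 z0; apply: le_trans (psi_ge _ _ _ n0 y0 z0); exact: W0.
    apply: ge0_le_integral => //.
    + by move=> q [_ [/posP y0 _]]; rewrite lee_fin mulr_ge0// W0.
    + apply/measurable_EFinP; apply: measurable_funM => //.
      exact: measurable_on_cylinder.
    + apply/measurable_EFinP; apply: measurable_funM => //.
      have mpsi := measurable_psi_tilde hb (measurable_weight_defect hg n.+1%:R)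
        (fun x _ => weight_defect_ge0 g n.+1%:R x).
      apply: (@measurable_comp _ _ _ _ _ _ (pos `*` pos)
        (fun r => psi_tilde b (weight_defect g n.+1%:R) r.1 r.2) (cylinder t)
        (fun q => q.2)) => //.
      * by apply: measurableX; exact: measurable_pos.
      * by move=> _ [q [_ ?] <-].
      * exact: (measurable_funTS measurable_snd).
    + move=> q [_ [/posP y0 /posP z0]]; rewrite lee_fin ler_wpM2r//.
      exact: psi_ge.
have rhs_fin : (\int[leb]_(x in pos) (g x * `|fin x|)%:E < +oo)%E.
  have /integrableP[_] := gfin; apply: le_lt_trans.
  rewrite le_eqVlt; apply/orP; left; apply/eqP.
  apply: eq_integral => x; rewrite inE => /posP x0.
  by rewrite /= normrM gtr0_norm// g0.
have -> : (\int[leb \x measure_product leb leb]_(q in cylinder t)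
      (g q.2.1 * `|K q|)%:E =
    \int[leb \x measure_product leb leb]_(q in cylinder t)
      ((theta^-1)%:E * (theta * g q.2.1 * `|K q|)%:E))%E.
  by apply: eq_integral => q _; rewrite -EFinM -!mulrA mulKf// gt_eqF.
rewrite ge0_integralZl//.
- rewrite lte_mul_pinfty// ?lee_fin ?invr_ge0 ?ltW//.
  exact: le_lt_trans rhs_fin.
- apply/measurable_EFinP; apply: measurable_funM => //.
  by apply: measurable_funM => //; exact: measurable_on_cylinder.
- move=> q [_ [/posP y0 _]].
  by rewrite lee_fin mulr_ge0// mulr_ge0 ?(ltW th0)// ltW// g0.
- by rewrite lee_fin invr_ge0 ltW.
Qed.

(** Small y are controlled by the unweighted rate and large y by the weight g,
    because g(y) >= g(1) y for y >= 1. *)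
Lemma mass_rate_finite :
  (\int[leb \x measure_product leb leb]_(q in cylinder t)
     (q.2.1 * `|K q|)%:E < +oo)%E.
Proof.
have g0 x : 0 < x -> 0 < g x by exact: (wc_gt0 hg).
have g1 := g0 _ ltr01.
have mg := measurable_weight hg.
have K_fin : (\int[leb \x measure_product leb leb]_(q in cylinder t)
    `|K q|%:E < +oo)%E.
  by have /integrableP[_] := ws_integrable hf It t0.
apply: (@le_lt_trans _ _ (\int[leb \x measure_product leb leb]_(q in cylinder t)
    (`|K q|%:E + (g 1)^-1%:E * (g q.2.1 * `|K q|)%:E))%E).
  apply: ge0_le_integral => //.
  - by move=> q [_ [/posP y0 _]]; rewrite lee_fin mulr_ge0// ltW.
  - apply/measurable_EFinP; apply: measurable_funM => //.
    exact: (measurable_on_cylinder (u := id)).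
  - apply/measurable_EFinP; apply: measurable_funD => //.
    do 2!apply: measurable_funM => //.
    exact: measurable_on_cylinder.
  - move=> q [_ [/posP y0 _]]; rewrite -EFinM -EFinD lee_fin.
    rewrite mulrA -[X in X + _]mul1r -mulrDl ler_wpM2r//.
    have [y1|/ltW y1] := leP q.2.1 1.
      by rewrite (le_trans y1)// lerDl mulr_ge0 ?invr_ge0 ?ltW// g0.
    rewrite (le_trans (y := (g 1)^-1 * g q.2.1))// ?lerDr//.
    have := wc_homo hg ltr01 y1; rewrite divr1 ler_pdivlMr// => H.
    by rewrite ler_pdivlMl//.
rewrite ge0_integralD//; first last.
- apply/measurable_EFinP; do 2!apply: measurable_funM => //.
  exact: measurable_on_cylinder.
- move=> q [_ [/posP y0 _]].
  by rewrite -EFinM lee_fin mulr_ge0 ?invr_ge0 ?(ltW g1)// mulr_ge0// ltW// g0.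
- exact/measurable_EFinP.
rewrite lte_add_pinfty//.
rewrite ge0_integralZl//.
- rewrite lte_mul_pinfty ?lee_fin ?invr_ge0 ?ltW//.
  exact: weighted_rate_finite.
- apply/measurable_EFinP; apply: measurable_funM => //.
  exact: measurable_on_cylinder.
- by move=> q [_ [/posP y0 _]]; rewrite lee_fin mulr_ge0// ltW// g0.
- by rewrite lee_fin invr_ge0 ltW.
Qed.

End WeakSolutionEstimates.

(** * Initial time and conclusion *)

Lemma right_limit_ge (R : realType) (I : set R) (F : R -> R) (c t : R) :
    {within I, continuous F} -> I 0 -> 0 < t -> `]0, t[ `<=` I ->
    (forall s, `]0, t[%classic s -> c <= F s) ->
  c <= F 0.
Proof.
move=> /subspace_continuousP Fc I0 t0 sI cF; rewrite leNgt; apply/negP => F0c.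
have : \forall s \near within I (nbhs 0), F s < c.
  exact: (Fc _ I0 _ (lt_nbhsl F0c)).
move=> /nbhs_ballP[e /= e0 He].
pose s := Num.min e t / 2.
have met : 0 < Num.min e t by rewrite lt_min e0.
have s0 : 0 < s by rewrite divr_gt0.
have slt : s < Num.min e t by rewrite ltr_pdivrMr// ltr_pMr// ltr1n.
have se : s < e by apply: lt_le_trans slt _; rewrite ge_min lexx.
have st : `]0, t[%classic s.
  by rewrite /= in_itv /= s0 (lt_le_trans slt)// ge_min lexx orbT.
have := He s _ (sI _ st); rewrite /ball /= sub0r normrN gtr0_norm// => /(_ se).
by rewrite ltNge cF.
Qed.

Theorem corollary5p2 (R : realType)
  (a : R -> R -> R) (A0 : R) (w0 winf : R -> R)
  (ha : collision_kernel a A0 w0 winf)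
  (b : R -> R -> R -> R) (beta0 p Bp : R)
  (hb : daughter_distribution b beta0 p Bp)
  (A1 l : R) (hA1 : 0 < A1) (hl : 0 <= l)
  (hw0 : forall x : R, 0 < x < 1 -> w0 x <= A1 * x `^ l)
  (g : R -> R) (hg : weight_class b g)
  (fin : R -> R) (hfin0 : Lone pos fin) (hfin : Xi g fin)
  (hfin_ge0 : ae_nonneg pos fin)
  (T : \bar R)
  (hT : (2^-1 < l /\ T = +oo%E) \/ (0 < l < 2^-1 /\ (0 < T < +oo)%E))
  (Fs : nat -> R -> R -> R)
  (hFs : forall n : nat, (0 < n)%N -> truncated_solution a b fin n (Fs n))
  (f : R -> R -> R)
  (hf : constructed_weak_solution a b g fin Fs T f) :
  (forall t : R, 0 < t -> (t%:E < T)%E ->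
     leb.-integrable `]0, t[
       (fun s => \int[leb]_(z in pos) \int[leb]_(y in pos)
                   (y * a y z * f s y * f s z)%:E)%E)
  /\ (forall t : R, 0 <= t -> (t%:E < T)%E -> mass (f t) = mass fin).
Proof.
case: hf => hweak _ _ hmass.
have T0 : (0 < T)%E by case: hT => [[_ ->]|[_ /andP[]]].
pose I := existence_interval T.
have II t : 0 <= t -> (t%:E < T)%E -> I t by move=> ? /ltW.
have sI t : (t%:E < T)%E -> `]0, t[ `<=` I.
  move=> tT s; rewrite /= in_itv /= => /andP[s0 st]; apply: II (ltW s0) _.
  by apply: lt_trans tT; rewrite lte_fin.
have a_ge0 := ck_ge0 ha.
have gfin : Lone pos (fun x => g x * fin x) := hfin.2.
split=> [t t0 tT|t t0 tT].
  have It := II _ (ltW t0) tT.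
  apply: (weak_rate_integrable a_ge0 hweak It t0 (sI _ tT) (W := fst)).
  - exact: measurable_funTS measurable_fst.
  - by move=> y z /posP y0 _ /=; exact: ltW.
  - exact: (mass_rate_finite hb a_ge0 hfin0 hfin_ge0 hweak It t0 (sI _ tT)
      (hmass _ It) hg gfin).
apply/eqP; rewrite eq_le (hmass _ (II _ t0 tT))/=.
have It := II _ t0 tT.
have ift : Lone pos (f t) by exact: (ws_cont hweak).1.
have ft0 := ws_ge0 hweak It.
apply: mass_le_of_min => // m m0; apply: le_trans (min_le_mass ift ft0 m0).
(* Positive times are covered by the weak formulation; at t = 0 the bound is
   inherited from small positive times. *)
move: t0; rewrite le_eqVlt => /predU1P[t0|t0]; last first.
  exact: (mass_min_nondecreasing hb a_ge0 hfin0 hfin_ge0 hweak It t0 (sI _ tT)).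
subst t.
have [e e0 eT] : exists2 e : R, 0 < e & (e%:E < T)%E.
  move: T0 {hT hweak hmass I II sI tT It ift ft0}.
  case: T => [r| |]// r0; last by exists 1 => //; exact: ltry.
  by exists (r / 2); rewrite ?divr_gt0// lte_fin ltr_pdivrMr// ltr_pMr// ltr1n.
have mmin := @measurable_minr_cst R m.
have bmin x : 0 < x -> `|Num.min x m| <= m.
  by move=> x0; rewrite ger0_norm ?ge_min ?lexx ?orbT// le_min !ltW.
have Lmin : Linfty pos (Num.min^~ m).
  by split=> //; exists m; apply: aeW => x /posP; exact: bmin.
have fin_min u : Lone pos u ->
    (\int[leb]_(x in pos) (Num.min x m * u x)%:E)%E \is a fin_num.
  move=> iu; apply: (@integrable_fin_num _ _ R leb _ (@measurable_pos R)).
  exact: integrable_bounded_test iu mmin bmin.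
rewrite -!integral_ae_nonneg_abs//.
rewrite -(fineK (fin_min _ hfin0)) -(fineK (fin_min _ ift)) lee_fin.
apply: (right_limit_ge ((ws_cont hweak).2 _ Lmin) It e0 (sI _ eT)) => s se.
have Is := sI _ eT _ se.
have s0 : 0 < s by move: se; rewrite /= in_itv /= => /andP[].
have sT : (s%:E < T)%E.
  by apply: lt_trans eT; move: se; rewrite /= in_itv /= lte_fin => /andP[].
have ifs : Lone pos (f s) by exact: (ws_cont hweak).1.
rewrite fine_le ?fin_min//.
rewrite (integral_ae_nonneg_abs hfin0 hfin_ge0 mmin).
rewrite (integral_ae_nonneg_abs ifs (ws_ge0 hweak Is) mmin).
exact: (mass_min_nondecreasing hb a_ge0 hfin0 hfin_ge0 hweak Is s0 (sI _ sT)).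
Qed.
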